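(* Let $a, b, x_{-}, x_{+}$ be real numbers such that $x_{-}<x_{+}$, and set $a_{n}=a\,x_{+}^{n}+b\,x_{-}^{n}$ for all integers $n\ge 0$. Then the sequence $(a_{n})_{n\ge 0}$ is generated recursively from the starting terms $a_{0}=a+b$ and $a_{1}=a x_{+}+b x_{-}$ through the recurrence relation $$a_{n}=A a_{n-1}+B a_{n-2}\qquad\text{for all integers } n\ge 2,$$ where $A=x_{+}+x_{-}$ and $B=-x_{+}x_{-}$.
   Context: Convention: $x^{0}=1$ for every real $x$, including $x=0$. *)

(* Defs.v *)
(* Stdlib reals; [x ^ n] is [pow x n], so [x ^ 0 = 1] also for [x = 0]. *)
From Stdlib Require Export Reals.

(* Main.v *)
Require Import Defs.
From Stdlib Require Import Reals Lia.
Open Scope R_scope.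

(** By Vieta, [x_plus] and [x_minus] are the roots of [t^2 = A t + B]. Multiplying by [t^m] shows
    that both geometric sequences satisfy the recurrence, hence so does their linear combination
    [s]. *)

Theorem proposition1 (a b x_minus x_plus : R) (hx : x_minus < x_plus) :
  let s := fun n : nat => a * x_plus ^ n + b * x_minus ^ n in
  let A := x_plus + x_minus in
  let B := - (x_plus * x_minus) in
  s 0%nat = a + b /\
  s 1%nat = a * x_plus + b * x_minus /\
  (forall n : nat, (2 <= n)%nat -> s n = A * s (n - 1)%nat + B * s (n - 2)%nat).
Proof.
  intros s A B; unfold s, A, B.
  split; [ring | split; [ring |]].
  intros n hn.
  (* With [n = m + 2] the truncated subtractions become the true indices [m + 1] and [m]. *)
  destruct n as [|[|m]]; [lia | lia |].
  replace (S (S m) - 1)%nat with (S m) by lia.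
  replace (S (S m) - 2)%nat with m by lia.
  (* Unfolding leaves a polynomial identity in which [x_plus ^ m] and [x_minus ^ m] are atoms. *)
  simpl; ring.
Qed.
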